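(* Let $n,k$ be integers with $1\le k\le n-1$. Consider the booby trap search game with $n$ boxes and $k$ booby traps on the complete hypergraph on $[n]$ with rewards $r_j=1$ for all $j\in[n]$. It is optimal for the Hider to choose $H\in[n]^{(k)}$ uniformly at random. It is optimal for the Searcher to open a uniformly random set of $m^*$ boxes, where $$m^*=\left\lceil\frac{n-k}{k+1}\right\rceil .$$ In particular, $m^*=1$ if $k\ge\frac{n-1}{2}$. The value of the game is $$U(n,k)=\frac{\binom{n-m^*}{k}\,m^*}{\binom nk}.$$
   Context: The booby trap search game: there are $n$ boxes, identified with the vertex set $[n]=\{1,\dots,n\}$ of a hypergraph $G$ with set of hyperedges $E\subseteq 2^{[n]}$. Box $i$ contains a reward $r_i$. A Hider pure strategy is a set $H\in[n]^{(k)}=\{H\subseteq[n]:|H|=k\}$ (the booby trapped boxes). A Searcher pure strategy is a hyperedge $S\in E$ (the boxes opened). The payoff (to the maximizing Searcher, in a zero-sum game against the minimizing Hider) is $R(S,H)=r(S):=\sum_{i\in S}r_i$ if $S\cap H=\emptyset$, and $R(S,H)=0$ otherwise. Mixed strategies are probability distributions over pure strategies, and payoffs extend by expectation. Value and optimal strategies are in the usual sense for finite two-person zero-sum games. In the complete hypergraph, $E=2^{[n]}$, so the Searcher may open any subset of $[n]$. *)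

(* Defs.v *)
From mathcomp Require Import all_boot all_order all_algebra.

Set Implicit Arguments.
Unset Strict Implicit.
Unset Printing Implicit Defensive.

Import Order.TTheory GRing.Theory Num.Theory.
Local Open Scope ring_scope.

Section ZeroSumGame.
Variables (R : realFieldType) (S T : finType).
(* The row player maximizes [pay] over the pure strategies in [A], the column
   player minimizes it over those in [B]. *)
Variables (A : {set S}) (B : {set T}) (pay : S -> T -> R).

Definition mixed (X : finType) (D : {set X}) (p : {ffun X -> R}) : Prop :=
  [/\ forall x, 0 <= p x,
      forall x, x \notin D -> p x = 0
    & \sum_(x in D) p x = 1].

Definition expected_payoff (p : {ffun S -> R}) (q : {ffun T -> R}) : R :=
  \sum_(s in A) \sum_(t in B) p s * q t * pay s t.

Definition row_guarantees (p : {ffun S -> R}) (v : R) : Prop :=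
  mixed A p /\ forall q, mixed B q -> v <= expected_payoff p q.

Definition col_guarantees (q : {ffun T -> R}) (v : R) : Prop :=
  mixed B q /\ forall p, mixed A p -> expected_payoff p q <= v.

(* Such a [v] is both max_p min_q and min_q max_p of the expected payoff. *)
Definition is_game_value (v : R) : Prop :=
  (exists p, row_guarantees p v) /\ (exists q, col_guarantees q v).

Definition row_optimal (p : {ffun S -> R}) : Prop :=
  exists2 v, is_game_value v & row_guarantees p v.

Definition col_optimal (q : {ffun T -> R}) : Prop :=
  exists2 v, is_game_value v & col_guarantees q v.

Lemma is_game_value_uniq v w : is_game_value v -> is_game_value w -> v = w.
Proof.
move=> [[p [mp hp]] [q [mq hq]]] [[p' [mp' hp']] [q' [mq' hq']]].
apply/eqP; rewrite eq_le (le_trans (hp _ mq') (hq' _ mp)).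
exact: le_trans (hp' _ mq) (hq _ mp').
Qed.

End ZeroSumGame.

Definition uniform (R : realFieldType) (X : finType) (D : {set X}) :
    {ffun X -> R} :=
  [ffun x => if x \in D then #|D|%:R^-1 else 0].

(* Boxes are numbered 0, ..., n - 1. *)
Definition ksets (n k : nat) : {set {set 'I_n}} := [set H : {set 'I_n} | #|H| == k].

Definition trap_payoff (R : realFieldType) (n : nat) (r : 'I_n -> R)
    (S H : {set 'I_n}) : R :=
  if [disjoint S & H] then \sum_(i in S) r i else 0.

(* Here [E] is the set of hyperedges; the Searcher is the row player and the
   Hider the column player. *)
Definition is_trap_value (R : realFieldType) (n k : nat)
    (E : {set {set 'I_n}}) (r : 'I_n -> R) (v : R) : Prop :=
  is_game_value E (ksets n k) (trap_payoff r) v.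

Definition searcher_optimal (R : realFieldType) (n k : nat)
    (E : {set {set 'I_n}}) (r : 'I_n -> R) (p : {ffun {set 'I_n} -> R}) : Prop :=
  row_optimal E (ksets n k) (trap_payoff r) p.

Definition hider_optimal (R : realFieldType) (n k : nat)
    (E : {set {set 'I_n}}) (r : 'I_n -> R) (q : {ffun {set 'I_n} -> R}) : Prop :=
  col_optimal E (ksets n k) (trap_payoff r) q.

Definition complete_hypergraph (n : nat) : {set {set 'I_n}} := [set: {set 'I_n}].

(* [Num.ceil] is int-valued; the absolute value only serves to land in [nat],
   the ceiling being nonnegative whenever k <= n. *)
Definition mstar (n k : nat) : nat :=
  `|Num.ceil ((n%:R - k%:R) / (k%:R + 1) : rat)|%N.

(* Main.v *)
(* Against a uniform Hider a searched set of size s has expected payoff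
   s * C(n-s,k) / C(n,k), and against a Searcher opening a uniform m-set every
   k-set has expected payoff m * C(n-k,m) / C(n,m).  For s = m these agree,
   since C(n,k) C(n-k,m) = C(n,m) C(n-m,k), so it suffices that m* maximizes
   s * C(n-s,k).  The ratio of consecutive values is at least (at most) 1
   exactly when s (k+1) is at most (at least) n - k; and m*, the ceiling of
   (n-k)/(k+1), is also the floor of n/(k+1). *)
Require Import Defs.
From mathcomp Require Import all_boot all_order all_algebra.
From mathcomp Require Import zify lra.

Import Order.TTheory GRing.Theory Num.Theory.
Local Open Scope ring_scope.

Lemma mixed_uniform (R : realFieldType) (X : finType) (D : {set X}) :
  D != set0 -> mixed D (uniform R D).
Proof.
move=> D0; have cD : #|D|%:R != 0 :> R by rewrite pnatr_eq0 cards_eq0.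
split=> [x|x /negbTE xD|].
- by rewrite ffunE; case: ifP => // _; rewrite invr_ge0 ler0n.
- by rewrite ffunE xD.
- rewrite (eq_bigr (fun=> #|D|%:R^-1)) => [|x xD]; last by rewrite ffunE xD.
  by rewrite sumr_const -[LHS]mulr_natl mulfV.
Qed.

Section PureResponses.
Variables (R : realFieldType) (S T : finType).
Variables (A : {set S}) (B : {set T}) (pay : S -> T -> R).

(** The expected payoff is the [q]-average of the payoffs against single columns, so a bound on each
    column passes to every mixture. *)
Lemma row_guarantees_pure (p : {ffun S -> R}) (v : R) : mixed A p ->
  (forall t, t \in B -> v <= \sum_(s in A) p s * pay s t) ->
  row_guarantees A B pay p v.
Proof.
move=> mp hp; split=> // q [q0 _ q1].
rewrite /expected_payoff exchange_big /= -[v]mul1r -q1 mulr_suml.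
apply: ler_sum => t tB.
have -> : \sum_(s in A) p s * q t * pay s t = q t * \sum_(s in A) p s * pay s t.
  by rewrite mulr_sumr; apply: eq_bigr => s _; rewrite mulrAC mulrC.
by rewrite ler_wpM2l ?hp.
Qed.

Lemma col_guarantees_pure (q : {ffun T -> R}) (v : R) : mixed B q ->
  (forall s, s \in A -> \sum_(t in B) q t * pay s t <= v) ->
  col_guarantees A B pay q v.
Proof.
move=> mq hq; split=> // p [p0 _ p1].
rewrite /expected_payoff -[v]mul1r -p1 mulr_suml.
apply: ler_sum => s sA.
have -> : \sum_(t in B) p s * q t * pay s t = p s * \sum_(t in B) q t * pay s t.
  by rewrite mulr_sumr; apply: eq_bigr => t _; rewrite mulrA.
by rewrite ler_wpM2l ?hq.
Qed.

End PureResponses.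

Lemma card_ksets (n k : nat) : #|ksets n k| = 'C(n, k).
Proof. by rewrite card_draws card_ord. Qed.

Lemma ksets_neq0 (n k : nat) : (k <= n)%N -> ksets n k != set0.
Proof. by move=> kn; rewrite -card_gt0 card_ksets bin_gt0. Qed.

Lemma card_ksets_disjoint (n k : nat) (S : {set 'I_n}) :
  #|[set H in ksets n k | [disjoint S & H]]| = 'C(n - #|S|, k).
Proof.
have <- : #|~: S| = (n - #|S|)%N by rewrite cardsCs setCK card_ord.
rewrite -cards_draws; congr #|pred_of_set _|; apply/setP => H.
by rewrite !inE disjoint_sym disjoints_subset andbC.
Qed.

Lemma sum_if_disjoint (R : realFieldType) (n k : nat) (S : {set 'I_n}) (c : R) :
  \sum_(H in ksets n k) (if [disjoint S & H] then c else 0)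
    = 'C(n - #|S|, k)%:R * c.
Proof.
rewrite -big_mkcondr /= -card_ksets_disjoint mulr_natl -sumr_const.
by apply: eq_bigl => H; rewrite !inE.
Qed.

Lemma trap_payoff_unit (R : realFieldType) (n : nat) (S H : {set 'I_n}) :
  trap_payoff (fun=> 1 : R) S H = if [disjoint S & H] then #|S|%:R else 0.
Proof. by rewrite /trap_payoff sumr_const. Qed.

Lemma payoff_uniform_hider (R : realFieldType) (n k : nat) (S : {set 'I_n}) :
  \sum_(H in ksets n k) uniform R (ksets n k) H * trap_payoff (fun=> 1) S H
    = 'C(n - #|S|, k)%:R * #|S|%:R / 'C(n, k)%:R.
Proof.
rewrite mulrC -sum_if_disjoint mulr_sumr; apply: eq_bigr => H HK.
by rewrite ffunE HK card_ksets trap_payoff_unit.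
Qed.

Lemma payoff_uniform_searcher (R : realFieldType) (n m : nat) (H : {set 'I_n}) :
  \sum_(S in complete_hypergraph n)
     uniform R (ksets n m) S * trap_payoff (fun=> 1) S H
    = 'C(n - #|H|, m)%:R * m%:R / 'C(n, m)%:R.
Proof.
rewrite (bigID (mem (ksets n m))) /= [X in _ + X]big1 ?addr0 => [|S]; last first.
  by case/andP=> _ /negbTE SK; rewrite ffunE SK mul0r.
rewrite mulrC -sum_if_disjoint mulr_sumr.
apply: eq_big => [S|S /andP[_ SK]]; first by rewrite in_setT.
rewrite ffunE SK card_ksets trap_payoff_unit disjoint_sym.
by move: SK; rewrite inE => /eqP ->.
Qed.

(** Both sides count the disjoint pairs of a k-set and an m-set: either member may be chosen
    first. *)
Lemma bin_disjoint_pairs (n k m : nat) : (k + m <= n)%N ->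
  ('C(n, k) * 'C(n - k, m) = 'C(n, m) * 'C(n - m, k))%N.
Proof.
move=> kmn; have kn : (k <= n)%N by lia.
have mn : (m <= n)%N by lia.
have mnk : (m <= n - k)%N by lia.
have knm : (k <= n - m)%N by lia.
have E : (n - m - k = n - k - m)%N by lia.
have := bin_fact kn; have := bin_fact mn.
have := bin_fact mnk; have := bin_fact knm; rewrite E => <- <- <- e.
(* Multiplied by k! m! (n-k-m)!, each side becomes n!; this is what [e] records. *)
apply/eqP; rewrite -(eqn_pmul2r (fact_gt0 k)) -(eqn_pmul2r (fact_gt0 m)).
rewrite -(eqn_pmul2r (fact_gt0 (n - k - m))); apply/eqP.
by nia.
Qed.

(** The payoff of an s-set against the uniform Hider with the constant denominator C(n,k) cleared,
    so that maximization takes place in [nat]. *)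
Definition total_payoff (n k s : nat) : nat := ('C(n - s, k) * s)%N.

(** The ratio of consecutive values, free of division; it rests on (n-s) C(n-s-1,k) = (n-s-k)
    C(n-s,k). *)
Lemma total_payoffS (n k s : nat) : (s < n)%N ->
  ((n - s) * total_payoff n k s.+1 = (n - s - k) * s.+1 * 'C(n - s, k))%N.
Proof.
move=> sn; have /= := mul_bin_down (n - s) k.
by rewrite /total_payoff -subnS mulnA => ->; rewrite mulnAC.
Qed.

Lemma total_payoff_up (n k s : nat) : (0 < k)%N -> (s * k.+1 + k <= n)%N ->
  (total_payoff n k s <= total_payoff n k s.+1)%N.
Proof.
move=> k0 h; have sn : (s < n)%N by nia.
rewrite -(@leq_pmul2l (n - s)) ?subn_gt0 // total_payoffS // /total_payoff.
(* Without the common factor C(n-s,k) the claim is (n-s)s <= (n-s-k)(s+1), which expands to [h]. *)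
rewrite mulnCA mulnC leq_mul2r; apply/orP; right; nia.
Qed.

Lemma total_payoff_down (n k s : nat) : (0 < k)%N -> (n <= s * k.+1 + k)%N ->
  (total_payoff n k s.+1 <= total_payoff n k s)%N.
Proof.
move=> k0 h; have [sn|ns] := ltnP s n; last first.
  (* Beyond [n] the truncated subtraction leaves C(0,k), which vanishes as k > 0. *)
  have E : (n - s.+1 = 0)%N by lia.
  by rewrite /total_payoff E bin0n eqn0Ngt k0.
rewrite -(@leq_pmul2l (n - s)) ?subn_gt0 // total_payoffS // /total_payoff.
rewrite [X in (_ <= X)%N]mulnCA [X in (_ <= X)%N]mulnC leq_mul2r.
apply/orP; right; nia.
Qed.

(** Unimodality: steps starting below n %/ (k+1) go up and the others go down, so induction on the
    distance to that point suffices. *)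
Lemma total_payoff_max (n k s : nat) : (0 < k)%N ->
  (total_payoff n k s <= total_payoff n k (n %/ k.+1))%N.
Proof.
move=> k0; set m := (n %/ k.+1)%N.
have ub : (m * k.+1 <= n)%N by apply: leq_divM.
have lb : (n < m.+1 * k.+1)%N by apply: ltn_ceil.
have [sm|/ltnW ms] := leqP s m.
  rewrite -(subnKC sm); move: (m - s)%N (subnKC sm) => d.
  elim: d s {sm} => [|d IH] s E; first by rewrite addn0.
  apply: leq_trans (total_payoff_up _ _ _ k0 _) _; first by nia.
  by rewrite addnS -addSn IH //; lia.
rewrite -(subnKC ms); elim: (s - m)%N => [|d IH]; first by rewrite addn0.
rewrite addnS; apply: leq_trans IH; apply: total_payoff_down => //; nia.
Qed.

(** For integers, m-1 < (n-k)/(k+1) <= m says the same as m(k+1) <= n < (m+1)(k+1). *)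
Lemma mstarE (n k : nat) : mstar n k = (n %/ k.+1)%N.
Proof.
rewrite /mstar; set m := (n %/ k.+1)%N.
have ub : (m * k.+1 <= n)%N by apply: leq_divM.
have lb : (n < m.+1 * k.+1)%N by apply: ltn_ceil.
have k1 : 0 < k%:R + 1 :> rat by rewrite natr1 ltr0n.
suff -> : Num.ceil ((n%:R - k%:R) / (k%:R + 1) : rat) = m%:Z by [].
apply: ceil_def; rewrite intrD /= ltr_pdivlMr // ler_pdivrMr //.
rewrite -!pmulrn natr1.
(* The strict bound [lb] is cast as n+1 <= (m+1)(k+1), which keeps the integer gap of one over the
   rationals. *)
move: lb ub; rewrite -!(ler_nat rat) !natrM -!natr1 => lb ub.
apply/andP; split; lra.
Qed.

Theorem theorem4 (R : realFieldType) (n k : nat)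
    (k_ge1 : (1 <= k)%N) (k_le : (k <= n - 1)%N) :
  [/\ hider_optimal k (complete_hypergraph n) (fun _ => 1 : R)
        (uniform R (ksets n k)),
      searcher_optimal k (complete_hypergraph n) (fun _ => 1 : R)
        (uniform R (ksets n (mstar n k))),
      (n%:R - 1) / 2%:R <= k%:R :> rat -> mstar n k = 1%N
    & is_trap_value k (complete_hypergraph n) (fun _ => 1 : R)
        ('C(n - mstar n k, k)%:R * (mstar n k)%:R / 'C(n, k)%:R)].
Proof.
have kn : (k < n)%N by lia.
rewrite mstarE; set m := (n %/ k.+1)%N; set v := _ / _.
have ub : (m * k.+1 <= n)%N by apply: leq_divM.
have m0 : (0 < m)%N by rewrite divn_gt0.
(* Since k and m are positive, k + m <= m(k+1) <= n. *)
have mkn : (k + m <= n)%N by nia.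
have mn : (m <= n)%N by lia.
have C0 a : (a <= n)%N -> 'C(n, a)%:R != 0 :> R.
  by move=> an; rewrite pnatr_eq0 -lt0n bin_gt0.
have rowP : row_guarantees (complete_hypergraph n) (ksets n k)
    (trap_payoff (fun=> 1)) (uniform R (ksets n m)) v.
  apply: row_guarantees_pure => [|H].
    have [p0 pD p1] := mixed_uniform R _ _ (ksets_neq0 _ _ mn).
    split=> // [S|]; first by rewrite in_setT.
    rewrite -p1 (bigID (mem (ksets n m))) /= addrC big1 ?add0r => [|S /andP[_]].
      by apply: eq_bigl => S; rewrite in_setT.
    exact: pD.
  (* Every k-set yields the same payoff, so the bound holds with equality, by double counting of
     disjoint pairs. *)
  rewrite inE => /eqP cH; rewrite payoff_uniform_searcher cH le_eqVlt.
  apply/orP; left; rewrite /v eqr_div ?C0 //; last exact: ltnW.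
  rewrite mulrAC [eqbRHS]mulrAC -!natrM; apply/eqP; congr (_ * _)%:R.
  by rewrite mulnC -bin_disjoint_pairs // mulnC.
have colP : col_guarantees (complete_hypergraph n) (ksets n k)
    (trap_payoff (fun=> 1)) (uniform R (ksets n k)) v.
  apply: col_guarantees_pure => [|S _].
    by apply: mixed_uniform; apply: ksets_neq0; apply: ltnW.
  rewrite payoff_uniform_hider /v ler_wpM2r ?invr_ge0 ?ler0n //.
  by rewrite -!natrM ler_nat total_payoff_max.
have valP : is_game_value (complete_hypergraph n) (ksets n k)
    (trap_payoff (fun=> 1)) v.
  by split; eexists; [apply: rowP|apply: colP].
split=> //; [by exists v|by exists v|].
(* The hypothesis amounts to n <= 2k+1 < 2(k+1), so the quotient [m] is below 2. *)
rewrite ler_pdivrMr ?ltr0n // lerBlDr -natrM natr1 ler_nat => n2k.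
apply/eqP; rewrite eqn_leq m0 andbT -ltnS ltn_divLR //; lia.
Qed.
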